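(* Let $ABCD$ be a (non-degenerate) rectangle in the Euclidean plane with center $I$ (the common midpoint of $AC$ and $BD$), and let $P$ be a point of the plane such that the triangles $PAB$, $PBC$, $PCD$, $PDA$ are all non-degenerate. 1) Suppose that the Euler lines of all four triangles are defined, that the Euler lines of triangles $PAB$ and $PCD$ meet at exactly one point $Q$, that the Euler lines of triangles $PBC$ and $PAD$ meet at exactly one point $R$, and that $Q\neq R$. Then the line $QR$ passes through $I$. 2) Suppose that the Brocard axes of all four triangles are defined, that the Brocard axes of triangles $PAB$ and $PCD$ meet at exactly one point $M$, that the Brocard axes of triangles $PBC$ and $PAD$ meet at exactly one point $N$, and that $M\neq N$. Then the line $MN$ passes through $P$.
   Context: The Euler line of a non-degenerate, non-equilateral triangle is the line through its centroid, orthocenter and circumcenter (for an equilateral triangle these points coincide and the Euler line is undefined). The symmedian point of a triangle is the common point of its three symmedians (a symmedian is the reflection of a median in the internal angle bisector at the same vertex). For a triangle $XYZ$ it is the point $$\frac{YZ^2\cdot X+ZX^2\cdot Y+XY^2\cdot Z}{YZ^2+ZX^2+XY^2},$$ where $YZ$, $ZX$, $XY$ denote side lengths and points are identified with their position vectors. The Brocard axis of a non-degenerate, non-equilateral triangle is the line through its circumcenter and its symmedian point (for an equilateral triangle these coincide and the Brocard axis is undefined). *)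

(* Defs.v *)
From mathcomp Require Import all_boot all_order all_algebra.
From mathcomp Require Import boolp classical_sets reals.
From mathcomp Require Import ring lra.

Set Implicit Arguments.
Unset Strict Implicit.
Unset Printing Implicit Defensive.

Import Order.TTheory GRing.Theory Num.Theory.
Local Open Scope classical_set_scope.
Local Open Scope ring_scope.

(* The Euclidean plane over R : realType is 'rV[R]_2 with the dot product
   below; the library norm on matrices is the sup norm, hence [dist]. *)
Section Plane.
Context {R : realType}.
Implicit Types (X Y Z W O H K : 'rV[R]_2) (L : set 'rV[R]_2).

Definition dot X Y : R := \sum_(i < 2) X 0 i * Y 0 i.

Definition dist X Y : R := Num.sqrt (dot (Y - X) (Y - X)).

(* This is {X} when X = Y; it is only a line when X != Y. *)
Definition line X Y : set 'rV[R]_2 := [set X + t *: (Y - X) | t in [set: R]].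

Definition is_line L : Prop := exists X Y, X != Y /\ L = line X Y.

Definition midpoint X Y : 'rV[R]_2 := 2^-1 *: (X + Y).

Definition nondegenerate_triangle X Y Z : Prop := free [:: Y - X; Z - X].

Definition equilateral X Y Z : Prop :=
  dist X Y = dist Y Z /\ dist Y Z = dist Z X.

(* The angle at Y between the rays YX and YZ. *)
Definition right_angle X Y Z : Prop :=
  [/\ X != Y, Z != Y & dot (X - Y) (Z - Y) = 0].

Definition rectangle A B C D : Prop :=
  [/\ right_angle D A B, right_angle A B C,
      right_angle B C D & right_angle C D A].

Definition centroid X Y Z : 'rV[R]_2 := 3^-1 *: (X + Y + Z).

Definition is_circumcenter O X Y Z : Prop :=
  dist O X = dist O Y /\ dist O Y = dist O Z.

Definition is_orthocenter H X Y Z : Prop :=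
  [/\ dot (H - X) (Z - Y) = 0, dot (H - Y) (X - Z) = 0
    & dot (H - Z) (Y - X) = 0].

(* For X Y Z non-degenerate, this determines L unless X Y Z is equilateral. *)
Definition is_euler_line L X Y Z : Prop :=
  [/\ is_line L,
      L (centroid X Y Z),
      exists2 H, is_orthocenter H X Y Z & L H
    & exists2 O, is_circumcenter O X Y Z & L O].

(* Reflection of W in [line X Y], for X != Y. *)
Definition reflection X Y W : 'rV[R]_2 :=
  let u := Y - X in
  X + (2 * dot (W - X) u / dot u u) *: u - (W - X).

(* A second point of the internal bisector at X: the sum of the unit vectors
   along XY and XZ, based at X. *)
Definition bisector_point X Y Z : 'rV[R]_2 :=
  X + (dist X Y)^-1 *: (Y - X) + (dist X Z)^-1 *: (Z - X).

Definition median X Y Z : set 'rV[R]_2 := line X (midpoint Y Z).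

Definition symmedian X Y Z : set 'rV[R]_2 :=
  reflection X (bisector_point X Y Z) @` median X Y Z.

Definition is_symmedian_point K X Y Z : Prop :=
  [/\ symmedian X Y Z K, symmedian Y Z X K & symmedian Z X Y K].

(* For X Y Z non-degenerate, this determines L unless X Y Z is equilateral. *)
Definition is_brocard_axis L X Y Z : Prop :=
  [/\ is_line L,
      exists2 O, is_circumcenter O X Y Z & L O
    & exists2 K, is_symmedian_point K X Y Z & L K].

Lemma dotE X Y : dot X Y = X 0 0 * Y 0 0 + X 0 1 * Y 0 1.
Proof.
rewrite /dot !big_ord_recl big_ord0 addr0.
by rewrite (_ : lift ord0 ord0 = 1) //; apply/val_inj.
Qed.

Lemma plane_eqP X Y : X = Y <-> X 0 0 = Y 0 0 /\ X 0 1 = Y 0 1.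
Proof.
split=> [-> //|[h0 h1]]; apply/rowP => -[[|[|//]] hi].
- by rewrite (_ : Ordinal hi = 0) //; apply/val_inj.
- by rewrite (_ : Ordinal hi = 1) //; apply/val_inj.
Qed.

Definition cross X Y : R := X 0 0 * Y 0 1 - X 0 1 * Y 0 0.

Lemma nondegenerate_triangleP X Y Z :
  nondegenerate_triangle X Y Z <-> cross (Y - X) (Z - X) != 0.
Proof.
rewrite /nondegenerate_triangle; move: (Y - X) (Z - X) => p q.
rewrite free_cons seq1_free span_seq1 /cross; split.
  move=> /andP[hpq hq]; apply: contra hpq => /eqP h; apply/vlineP.
  have [q0|q0] := eqVneq (q 0 0) 0.
    have q1 : q 0 1 != 0.
      by apply: contra hq => /eqP q1; apply/eqP/plane_eqP; rewrite q0 q1 !mxE.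
    exists (p 0 1 / q 0 1); apply/plane_eqP; rewrite !mxE; split; last by field.
    by move: h; rewrite q0 !mulr0 subr0 => /eqP; rewrite mulf_eq0 (negPf q1) orbF => /eqP.
  exists (p 0 0 / q 0 0); apply/plane_eqP; rewrite !mxE; split; first by field.
  by apply: (mulIf q0); rewrite mulrAC divfK //; lra.
move=> h; apply/andP; split.
  apply: contra h => /vlineP[k ->]; rewrite !mxE; apply/eqP; ring.
by apply: contra h => /eqP ->; rewrite !mxE !mulr0 subrr.
Qed.

Lemma dot_gt0 X : X != 0 -> 0 < dot X X.
Proof.
move=> X0; rewrite dotE -!expr2 lt_def addr_ge0 ?sqr_ge0 // andbT.
rewrite paddr_eq0 ?sqr_ge0 // !sqrf_eq0.
by apply: contra X0 => /andP[/eqP h0 /eqP h1]; apply/eqP/plane_eqP; rewrite !mxE.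
Qed.

Lemma dist_sqr X Y : dist X Y ^+ 2 = dot (Y - X) (Y - X).
Proof. by rewrite sqr_sqrtr // dotE -!expr2 addr_ge0 ?sqr_ge0. Qed.

Lemma dist_gt0 X Y : X != Y -> 0 < dist X Y.
Proof. by move=> XY; rewrite sqrtr_gt0 dot_gt0 // subr_eq0 eq_sym. Qed.

Lemma distC X Y : dist X Y = dist Y X.
Proof. by rewrite /dist !dotE !mxE; congr Num.sqrt; ring. Qed.

Lemma nondegenerate_rot X Y Z : nondegenerate_triangle X Y Z -> nondegenerate_triangle Y Z X.
Proof.
move=> /nondegenerate_triangleP h; apply/nondegenerate_triangleP; apply: contra h.
by rewrite /cross !mxE => /eqP h; apply/eqP; lra.
Qed.

Lemma nondegenerate_neq X Y Z : nondegenerate_triangle X Y Z -> X != Y.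
Proof.
move=> /nondegenerate_triangleP; apply: contra => /eqP ->.
by rewrite /cross !mxE !subrr !mul0r subrr.
Qed.

Lemma reflection_median X Y Z (t : R) : nondegenerate_triangle X Y Z ->
  reflection X (bisector_point X Y Z) (X + t *: (midpoint Y Z - X)) =
  X + (t / (2 * dist X Y * dist X Z)) *:
    (dist X Z ^+ 2 *: (Y - X) + dist X Y ^+ 2 *: (Z - X)).
Proof.
move=> ndg; have XY := dist_gt0 (nondegenerate_neq ndg).
have XZ : 0 < dist X Z.
  rewrite distC; apply: dist_gt0; apply: (@nondegenerate_neq Z X Y).
  by do 2 apply: nondegenerate_rot.
have m2 := dist_sqr X Y; have n2 := dist_sqr X Z.
move: ndg => /nondegenerate_triangleP.
rewrite /reflection /bisector_point /midpoint; move: XY XZ m2 n2.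
move: (dist X Y) (dist X Z) => m n m0 n0.
have -> : t *: (2^-1 *: (Y + Z) - X) = (t / 2) *: ((Y - X) + (Z - X)).
  by apply/plane_eqP; rewrite !mxE; split; field.
rewrite ![X + _ - X]addrAC !subrr !add0r.
move: (Y - X) (Z - X) => p q m2 n2 ndg.
set u := m^-1 *: p + n^-1 *: q.
have -> : X + m^-1 *: p + n^-1 *: q - X = u by rewrite -(addrA X) [X + _ - X]addrAC subrr add0r.
have pq : dot p q = p 0 0 * q 0 0 + p 0 1 * q 0 1 by rewrite dotE.
have uu : dot u u = 2 * (1 + dot p q / (m * n)).
  transitivity (dot p p / m ^+ 2 + dot q q / n ^+ 2 + 2 * dot p q / (m * n)).
    by rewrite !dotE !mxE; field; rewrite !gt_eqF.
  by rewrite -m2 -n2; field; rewrite !gt_eqF.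
have u0 : u != 0.
  apply: contra ndg => /eqP/plane_eqP; rewrite !mxE => -[h0 h1].
  apply/eqP; rewrite /cross.
  transitivity (m * ((m^-1 * p 0 0 + n^-1 * q 0 0) * q 0 1
    - (m^-1 * p 0 1 + n^-1 * q 0 1) * q 0 0)).
    by field; rewrite !gt_eqF.
  by rewrite h0 h1; ring.
have hpos := dot_gt0 u0; rewrite uu in hpos.
have vu : 2 * dot ((t / 2) *: (p + q)) u = t * (m + n) * (1 + dot p q / (m * n)).
  transitivity (t * (dot p p / m + dot q q / n + dot p q / m + dot p q / n)).
    by rewrite !dotE !mxE; field; rewrite !gt_eqF.
  by rewrite -m2 -n2; field; rewrite !gt_eqF.
rewrite uu.
have -> : 2 * dot ((t / 2) *: (p + q)) u / (2 * (1 + dot p q / (m * n)))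
   = t * (m + n) / 2.
  rewrite vu; field; rewrite !gt_eqF //=.
  have -> : m * n + dot p q = (m * n) * (1 + dot p q / (m * n)).
    by field; rewrite !gt_eqF.
  by rewrite !mulr_gt0 //; lra.
by apply/plane_eqP; rewrite !mxE; split; field; rewrite !gt_eqF.
Qed.

Lemma symmedianE X Y Z : nondegenerate_triangle X Y Z ->
  symmedian X Y Z =
  line X (X + (dist X Z ^+ 2 *: (Y - X) + dist X Y ^+ 2 *: (Z - X))).
Proof.
move=> ndg; have XY := dist_gt0 (nondegenerate_neq ndg).
have XZ : 0 < dist X Z.
  rewrite distC; apply: dist_gt0; apply: (@nondegenerate_neq Z X Y).
  by do 2 apply: nondegenerate_rot.
rewrite /symmedian /median /line; apply/seteqP; split=> [_ [_ [t _ <-] <-]|_ [t _ <-]].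
  rewrite reflection_median // [X + _ - X]addrAC subrr add0r.
  by eexists; last by [].
exists (X + (t * (2 * dist X Y * dist X Z)) *: (midpoint Y Z - X)).
  by eexists; last by [].
rewrite reflection_median // [X + _ - X]addrAC subrr add0r mulfK //.
by rewrite gt_eqF // !mulr_gt0.
Qed.

Lemma is_symmedian_pointE K X Y Z : nondegenerate_triangle X Y Z ->
  is_symmedian_point K X Y Z <->
  K = (dist Y Z ^+ 2 + dist Z X ^+ 2 + dist X Y ^+ 2)^-1 *:
      (dist Y Z ^+ 2 *: X + dist Z X ^+ 2 *: Y + dist X Y ^+ 2 *: Z).
Proof.
move=> ndg; have ndg' := nondegenerate_rot ndg; have ndg'' := nondegenerate_rot ndg'.
rewrite /is_symmedian_point !symmedianE // !(distC X Z) !(distC Y X) !(distC Z Y).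
have := dist_gt0 (nondegenerate_neq ndg).
have := dist_gt0 (nondegenerate_neq ndg').
have := dist_gt0 (nondegenerate_neq ndg'').
move/nondegenerate_triangleP: ndg; rewrite /cross !mxE => ndg.
move: (dist X Y) (dist Y Z) (dist Z X) => c a b b0 a0 c0.
have s0 : a ^+ 2 + b ^+ 2 + c ^+ 2 != 0.
  by rewrite gt_eqF // !addr_gt0 ?exprn_gt0.
split; last first.
  move=> ->; split.
  - exists (a ^+ 2 + b ^+ 2 + c ^+ 2)^-1 => //.
    by apply/plane_eqP; rewrite !mxE; split; field.
  - exists (a ^+ 2 + b ^+ 2 + c ^+ 2)^-1 => //.
    by apply/plane_eqP; rewrite !mxE; split; field.
  - exists (a ^+ 2 + b ^+ 2 + c ^+ 2)^-1 => //.
    by apply/plane_eqP; rewrite !mxE; split; field.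
case=> -[s _ <-] [t _ h] _; move/plane_eqP: h; rewrite !mxE => -[h0 h1].
set d := (X in X != 0) in ndg.
suff hs : s = (a ^+ 2 + b ^+ 2 + c ^+ 2)^-1.
  by rewrite hs; apply/plane_eqP; rewrite !mxE; split; field.
have e1 : (s * c ^+ 2 - t * c ^+ 2) * d = 0.
  have := congr1 (fun u => (Y 0 0 - X 0 0) * u) h1.
  have := congr1 (fun u => (Y 0 1 - X 0 1) * u) h0.
  by rewrite /d /=; lra.
have e2 : (s * b ^+ 2 - (1 - t * (a ^+ 2 + c ^+ 2))) * d = 0.
  have := congr1 (fun u => (Z 0 0 - X 0 0) * u) h1.
  have := congr1 (fun u => (Z 0 1 - X 0 1) * u) h0.
  by rewrite /d /=; lra.
move/eqP: e1; rewrite mulf_eq0 (negPf ndg) orbF -mulrBl mulf_eq0 sqrf_eq0 (gt_eqF c0) orbF.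
rewrite subr_eq0 => /eqP st; move/eqP: e2; rewrite mulf_eq0 (negPf ndg) orbF -st => /eqP e2.
apply: (mulIf s0); rewrite mulVf //; lra.
Qed.

End Plane.

(* Main.v *)
Require Import Defs.
From mathcomp Require Import all_boot all_order all_algebra.
From mathcomp Require Import boolp classical_sets reals.
From mathcomp Require Import ring lra.

Import Order.TTheory GRing.Theory Num.Theory.
Local Open Scope classical_set_scope.
Local Open Scope ring_scope.

(** Take the centre I as origin and the half-sides e = (B - A)/2 and
    f = (D - A)/2 as an orthogonal basis: the vertices become
    (-1,-1), (1,-1), (1,1), (-1,1), P = (x,y), and the dot product is
    p X X' + q Y Y' with p = e.e and q = f.f. Let w = p x^2 + q y^2 - p - q, the
    power of P with respect to the circle ABCD.

    The circumcenter of PAB is (0,k) with 2 q (y+1) k = w. Adding the centroid,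
    respectively the symmedian point, gives an equation of the Euler line or
    Brocard axis of PAB ([euler_side], [brocard_side]). The half-turn
    (e,f) -> (-e,-f) carries PAB to PCD, so the equation for the opposite side
    results from changing the signs of x, y, X and Y. If x = 0 both axes
    contain the whole perpendicular bisector of AB, so a unique common point
    forces x <> 0.

    Euler lines: eliminating w between the two equations leaves x Y + y X = 0 for the
    common point (X,Y) = Q ([euler_opposite_sides]). This line through I is
    preserved by the quarter-turn (e,f) -> (f,-e), which carries PAB and PCD to
    PBC and PDA; hence R lies on it as well.

    Brocard axes: solving the two equations gives d (M - P) =
    x U(p,q,x,y) e - y U(q,p,y,x) f for some d <> 0, where
    U = 4 n (p + q y^2) - (n + p + q)^2 and n = p x^2 + q y^2
    ([brocard_opposite_sides]). The right-hand side changes sign under the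
    quarter-turn, whence d (M - P) + d' (N - P) = 0, so that P is on MN. *)

(** * Lines in the plane *)

Section Lines.
Set Implicit Arguments.
Unset Strict Implicit.
Context {R : realType}.
Implicit Types (U V W : 'rV[R]_2) (L : set 'rV[R]_2).

Lemma is_line_through L U V :
  is_line L -> L U -> L V -> U != V -> L = line U V.
Proof.
move=> [X [Y [_ ->]]] [a _ <-] [b _ <-] UV.
have ab : b - a != 0.
  by apply: contra UV; rewrite subr_eq0 => /eqP ->.
apply/seteqP; split=> _ [t _ <-].
  exists ((t - a) / (b - a)) => //.
  by apply/plane_eqP; rewrite !mxE; split; field.
exists (a + t * (b - a)) => //.
by apply/plane_eqP; rewrite !mxE; split; ring.
Qed.

(** The hypothesis exhibits W as the barycenter of (U,a) and (V,b); the total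
    mass cannot vanish, because otherwise a (U - V) = 0. *)
Lemma line_barycenter U V W (a b : R) :
  U != V -> a *: (U - W) + b *: (V - W) = 0 -> a != 0 -> line U V W.
Proof.
move=> UV E a0.
have ab : a + b != 0.
  apply: contra UV => /eqP ab; have -> : U = V; last by [].
  have {}ab : b = - a by lra.
  rewrite ab in E.
  move/plane_eqP: E; rewrite !mxE => -[E0 E1].
  by apply/plane_eqP; split; apply: (mulfI a0); lra.
exists (b / (a + b)) => //.
move/plane_eqP: E; rewrite !mxE => -[E0 E1].
by apply/plane_eqP; rewrite !mxE; split; apply: (mulfI ab);
   rewrite mulrDr mulrA mulrCA divff // mulr1; lra.
Qed.

Lemma dist_eq_sqr U V U' V' :
  dot (V - U) (V - U) = dot (V' - U') (V' - U') -> dist U V = dist U' V'.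
Proof. by rewrite /dist => ->. Qed.

End Lines.

(** * Coordinates in an orthogonal frame *)

Section Frame.
Set Implicit Arguments.
Unset Strict Implicit.
Context {R : realType}.
Implicit Types (I e f U V : 'rV[R]_2) (L : set 'rV[R]_2) (x y X Y : R).

Definition orthogonal_frame e f : Prop := [/\ e != 0, f != 0 & dot e f = 0].

Definition pt I e f x y : 'rV[R]_2 := I + x *: e + y *: f.

(** The quarter-turn is what transports a computation on the side AB to the
    sides BC, CD and DA. *)
Lemma orthogonal_frame_turn e f :
  orthogonal_frame e f -> orthogonal_frame f (- e).
Proof.
move=> [e0 f0 ef]; split; rewrite ?oppr_eq0 //.
by move: ef; rewrite !dotE !mxE; lra.
Qed.

Lemma pt_turn I e f x y : pt I e f x y = pt I f (- e) y (- x).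
Proof. by apply/plane_eqP; rewrite !mxE; split; ring. Qed.

Lemma pt_half_turn I e f x y : pt I e f x y = pt I (- e) (- f) (- x) (- y).
Proof. by rewrite pt_turn pt_turn. Qed.

Lemma dot_frame e f x y X Y : dot e f = 0 ->
  dot (x *: e + y *: f) (X *: e + Y *: f)
  = dot e e * x * X + dot f f * y * Y.
Proof.
move=> ef.
transitivity (dot e e * x * X + dot f f * y * Y + dot e f * (x * Y + y * X)).
  by rewrite !dotE !mxE; ring.
by rewrite ef mul0r addr0.
Qed.

Lemma ptB I e f x y X Y :
  pt I e f X Y - pt I e f x y = (X - x) *: e + (Y - y) *: f.
Proof. by apply/plane_eqP; rewrite !mxE; split; ring. Qed.

Lemma dist_sqr_pt I e f x y X Y : dot e f = 0 ->
  dist (pt I e f x y) (pt I e f X Y) ^+ 2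
  = dot e e * (X - x) ^+ 2 + dot f f * (Y - y) ^+ 2.
Proof. by move=> ef; rewrite dist_sqr ptB dot_frame //; ring. Qed.

Lemma pt_inj I e f x y X Y : orthogonal_frame e f ->
  pt I e f x y = pt I e f X Y -> x = X /\ y = Y.
Proof.
move=> [e0 f0 ef] E.
have E0 : (x - X) *: e + (y - Y) *: f = 0 by rewrite -(ptB I) E subrr.
have p0 := dot_gt0 e0; have q0 := dot_gt0 f0.
have Ee : dot e e * (x - X) = 0.
  have := congr1 (fun u => dot u (1 *: e + 0 *: f)) E0.
  by rewrite dot_frame // [X in _ = X]dotE !mxE; lra.
have Ef : dot f f * (y - Y) = 0.
  have := congr1 (fun u => dot u (0 *: e + 1 *: f)) E0.
  by rewrite dot_frame // [X in _ = X]dotE !mxE; lra.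
split; apply: subr0_eq.
  by apply: (mulfI (lt0r_neq0 p0)); rewrite Ee mulr0.
by apply: (mulfI (lt0r_neq0 q0)); rewrite Ef mulr0.
Qed.

Lemma pt_surj I e f V : orthogonal_frame e f -> exists x y, V = pt I e f x y.
Proof.
move=> [e0 f0 ef].
have d0 : cross e f != 0.
  have : cross e f ^+ 2 != 0.
    have -> : cross e f ^+ 2 = dot e e * dot f f - dot e f ^+ 2.
      by rewrite /cross !dotE; ring.
    by rewrite ef expr0n subr0 gt_eqF // mulr_gt0 ?dot_gt0.
  by rewrite sqrf_eq0.
exists (cross (V - I) f / cross e f), (cross e (V - I) / cross e f).
move: d0; rewrite /cross !mxE => d0.
by apply/plane_eqP; rewrite !mxE; split; field.
Qed.

Lemma line_ptE I e f x1 y1 x2 y2 X Y : orthogonal_frame e f ->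
  pt I e f x1 y1 != pt I e f x2 y2 ->
  line (pt I e f x1 y1) (pt I e f x2 y2) (pt I e f X Y) <->
  (X - x1) * (y2 - y1) = (Y - y1) * (x2 - x1).
Proof.
move=> fr d; split.
  move=> [t _ E].
  have {}E : pt I e f (x1 + t * (x2 - x1)) (y1 + t * (y2 - y1)) = pt I e f X Y.
    by rewrite -E; apply/plane_eqP; rewrite !mxE; split; ring.
  by have [<- <-] := pt_inj fr E; ring.
move=> E.
have [x12|x12] := eqVneq x2 x1; last first.
  have x0 : x2 - x1 != 0 by rewrite subr_eq0.
  exists ((X - x1) / (x2 - x1)) => //.
  have -> : Y = y1 + (X - x1) / (x2 - x1) * (y2 - y1).
    by apply: (mulIf x0); rewrite mulrDl mulrAC divfK //; lra.
  by apply/plane_eqP; rewrite !mxE; split; field.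
have y0 : y2 - y1 != 0.
  by rewrite subr_eq0; apply: contra d => /eqP ->; rewrite x12.
exists ((Y - y1) / (y2 - y1)) => //.
have -> : X = x1.
  by apply: (mulIf y0); move: E; rewrite x12; lra.
by rewrite x12; apply/plane_eqP; rewrite !mxE; split; field.
Qed.

Lemma is_line_ptE I e f L x1 y1 x2 y2 : orthogonal_frame e f ->
  is_line L -> L (pt I e f x1 y1) -> L (pt I e f x2 y2) ->
  ~ (x1 = x2 /\ y1 = y2) ->
  forall X Y, L (pt I e f X Y) <->
    (X - x1) * (y2 - y1) = (Y - y1) * (x2 - x1).
Proof.
move=> fr HL L1 L2 ne X Y.
have d : pt I e f x1 y1 != pt I e f x2 y2.
  by apply/eqP => /(pt_inj fr).
by rewrite (is_line_through HL L1 L2 d); apply: line_ptE.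
Qed.

(** * The rectangle and one of its sides *)

Record rectangle_frame I e f A B C D : Prop := RectangleFrame {
  frame_orthogonal : orthogonal_frame e f;
  frame_A : A = pt I e f (-1) (-1);
  frame_B : B = pt I e f 1 (-1);
  frame_C : C = pt I e f 1 1;
  frame_D : D = pt I e f (-1) 1 }.

Lemma rectangle_frame_turn I e f A B C D :
  rectangle_frame I e f A B C D -> rectangle_frame I f (- e) B C D A.
Proof.
case=> fr -> -> -> ->; split; first exact: orthogonal_frame_turn.
all: by rewrite pt_turn ?opprK.
Qed.

Lemma rectangle_has_frame I A B C D : rectangle A B C D ->
  I = midpoint A C -> I = midpoint B D ->
  rectangle_frame I (2^-1 *: (B - A)) (2^-1 *: (D - A)) A B C D.
Proof.
move=> [[DA BA DAB] _ _ _] IAC IBD.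
have E : A + C = B + D.
  have h : 2^-1 != 0 :> R by rewrite invr_eq0 pnatr_eq0.
  by apply: (scalerI h); rewrite -[LHS]IAC.
have -> : C = B + D - A by rewrite -E addrC addKr.
split.
- split; rewrite ?scaler_eq0 ?invr_eq0 ?pnatr_eq0 ?subr_eq0 //.
  by move: DAB; rewrite !dotE !mxE; lra.
all: by rewrite IBD; apply/plane_eqP; rewrite !mxE; split; field.
Qed.

(** The power of the point (x,y) with respect to the circle through the vertices
    (1,1), (1,-1), (-1,1) and (-1,-1), where p and q are the squared lengths of
    the basis vectors. *)
Definition circle_power p q x y : R := p * x ^+ 2 + q * y ^+ 2 - p - q.

Section Side.
Context (I e f A B C D : 'rV[R]_2) (x y : R).
Context (fr : rectangle_frame I e f A B C D).
Let T := pt I e f.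
Let P := T x y.
Let p := dot e e.
Let q := dot f f.
Let w := circle_power p q x y.

Lemma nondegenerate_side : nondegenerate_triangle P A B -> y + 1 != 0.
Proof.
rewrite (frame_A fr) (frame_B fr).
move=> /nondegenerate_triangleP; apply: contra => /eqP y1.
rewrite /P; have -> : y = -1 by lra.
by rewrite /cross !mxE; apply/eqP; ring.
Qed.

Lemma circumcenter_side O : is_circumcenter O P A B ->
  exists k, O = T 0 k /\ 2 * q * (y + 1) * k = w.
Proof.
rewrite (frame_A fr) (frame_B fr).
have [a [k ->]] := pt_surj I O (frame_orthogonal fr).
have [e0 f0 ef] := frame_orthogonal fr; have p0 := dot_gt0 e0.
move=> [/(congr1 (fun u => u ^+ 2)) E1 /(congr1 (fun u => u ^+ 2)) E2].
move: E1 E2; rewrite !dist_sqr_pt // /w -/p -/q => E1 E2.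
have a0 : a = 0 by apply: (mulfI (lt0r_neq0 p0)); rewrite -/p; lra.
by exists k; rewrite a0; split=> //; move: E1; rewrite a0 /circle_power; lra.
Qed.

(** On the perpendicular bisector x = 0 of AB one has AB^2 = 4 p and
    PA^2 = PB^2 = p + q (y+1)^2. The circumcenter coincides with the centroid or
    the symmedian point only in this case. *)
Lemma equilateral_side : x = 0 -> q * (y + 1) ^+ 2 = 3 * p -> equilateral P A B.
Proof.
have [_ _ ef] := frame_orthogonal fr.
rewrite (frame_A fr) (frame_B fr) /P => -> E.
by split; apply: dist_eq_sqr; rewrite !ptB !dot_frame // -/p -/q; lra.
Qed.

(** The second point is given by homogeneous coordinates (g : h : d), and c
    clears the denominator of k, so that the equation is polynomial in the
    coordinates of P; it is used with c k = w. *)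
Lemma side_axisE L c k g h d : c != 0 -> d != 0 ->
  is_line L -> L (T 0 k) -> L (T (g / d) (h / d)) ->
  ~ (g = 0 /\ c * h = c * k * d) ->
  forall X Y, L (T X Y) <-> X * (c * h - c * k * d) = (c * Y - c * k) * g.
Proof.
move=> c0 d0 HL L1 L2 ne X Y.
rewrite (is_line_ptE (frame_orthogonal fr) HL L1 L2); last first.
  move=> [g0 hk]; apply: ne; split; last by rewrite hk; field.
  by apply: (mulIf (_ : d^-1 != 0)); rewrite ?invr_eq0 // -g0 mul0r.
have cd : c * d != 0 by rewrite mulf_neq0.
have -> : X * (c * h - c * k * d) = c * d * ((X - 0) * (h / d - k)) by field.
have -> : (c * Y - c * k) * g = c * d * ((Y - k) * (g / d - 0)) by field.
by split=> [->//|]; apply: mulfI.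
Qed.

Lemma euler_side L :
  nondegenerate_triangle P A B -> ~ equilateral P A B ->
  is_euler_line L P A B ->
  forall X Y, L (T X Y) <->
    X * (2 * q * (y + 1) * (y - 2) - w * 3) = (2 * q * (y + 1) * Y - w) * x.
Proof.
move=> /nondegenerate_side y1 neq [HL LG _ [O /circumcenter_side [k [-> wk]] LO]].
have [_ /dot_gt0 /lt0r_neq0 q0 _] := frame_orthogonal fr.
have c0 : 2 * q * (y + 1) != 0 by rewrite !mulf_neq0 ?pnatr_eq0.
have GE : centroid P A B = T (x / 3) ((y - 2) / 3).
  rewrite (frame_A fr) (frame_B fr).
  by apply/plane_eqP; rewrite !mxE; split; field.
rewrite GE in LG; rewrite -wk.
apply: side_axisE => //; first by rewrite pnatr_eq0.
rewrite wk => -[x0 hk]; apply: neq; apply: equilateral_side => //.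
(* For x = 0 the coincidence c h = w d reads q (y+1)^2 = 3 p. *)
by move: hk; rewrite /w /circle_power x0; lra.
Qed.

(** Here s = (PA^2 + PB^2)/2, and in the weights AB^2 = 4 p, PB^2 = s - 2 p x and
    PA^2 = s + 2 p x of P, A and B the symmedian point is
    (4 p x, 2 p y - s)/(s + 2 p). *)
Lemma brocard_side L : let s := p * x ^+ 2 + p + q * (y + 1) ^+ 2 in
  nondegenerate_triangle P A B -> ~ equilateral P A B ->
  is_brocard_axis L P A B ->
  forall X Y, L (T X Y) <->
    X * (2 * q * (y + 1) * (2 * p * y - s) - w * (s + 2 * p))
    = (2 * q * (y + 1) * Y - w) * (4 * p * x).
Proof.
move=> s ndg neq [HL [O /circumcenter_side [k [-> wk]] LO] [K HK LK]].
have y1 := nondegenerate_side ndg.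
have [e0 f0 ef] := frame_orthogonal fr.
have p0 := dot_gt0 e0; have q0 := dot_gt0 f0; rewrite -/p -/q in p0 q0.
have c0 : 2 * q * (y + 1) != 0.
  by rewrite !mulf_neq0 ?pnatr_eq0 ?(lt0r_neq0 q0).
have d0 : s + 2 * p != 0.
  apply: lt0r_neq0; have := mulr_ge0 (ltW p0) (sqr_ge0 x).
  have := mulr_ge0 (ltW q0) (sqr_ge0 (y + 1)).
  by rewrite /s; lra.
have KE : K = T (4 * p * x / (s + 2 * p)) ((2 * p * y - s) / (s + 2 * p)).
  move/(is_symmedian_pointE _ ndg): HK => ->.
  rewrite (frame_A fr) (frame_B fr) !dist_sqr_pt // -/p -/q.
  set t := (X in X^-1); have -> : t = 2 * (s + 2 * p) by rewrite /t /s; ring.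
  by rewrite /s in d0 *; apply/plane_eqP; rewrite !mxE; split; field.
rewrite KE in LK; rewrite -wk.
apply: side_axisE => //; rewrite wk => -[/eqP x0 hk].
apply: neq; have {}x0 : x = 0.
  by apply/eqP; move: x0; rewrite !mulf_eq0 pnatr_eq0 (negPf (lt0r_neq0 p0)).
apply: equilateral_side => //.
have h0 : 0 < p + q * (y + 1) ^+ 2.
  by have := mulr_ge0 (ltW q0) (sqr_ge0 (y + 1)); lra.
(* For x = 0 and u = q (y+1)^2 the coincidence c h = w d reads
   (3 p - u) (p + u) = 0. *)
by apply: (mulfI (lt0r_neq0 h0)); move: hk; rewrite /s /w /circle_power x0; lra.
Qed.

End Side.

(** * Opposite sides *)

(** If g = 0, the axes are both invariant under translation along f: with a common
    point they share the whole line through it, so that the common point is not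
    unique. *)
Lemma opposite_axes_meet I e f g c a w c' a' w' L L' Q :
  orthogonal_frame e f ->
  (forall X Y, L (pt I e f X Y) <-> X * c = (a * Y - w) * g) ->
  (forall X Y, L' (pt I (- e) (- f) X Y) <-> X * c' = (a' * Y - w') * - g) ->
  L `&` L' = [set Q] ->
  g != 0 /\ exists X Y, [/\ Q = pt I e f X Y,
    X * c = (a * Y - w) * g & - X * c' = (a' * - Y - w') * - g].
Proof.
move=> fr LE LE' QE.
have [LQ LQ'] : (L `&` L') Q by rewrite QE.
have [X [Y XY]] := pt_surj I Q fr.
rewrite XY in LQ; rewrite XY pt_half_turn in LQ'.
move: (LQ) (LQ') => /LE E /LE' E'.
split; last by exists X, Y.
apply/eqP => g0; rewrite g0 !(oppr0, mulr0) in E E'.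
have : (L `&` L') (pt I e f X (Y + 1)).
  split; first by apply/LE; rewrite g0 mulr0.
  by rewrite pt_half_turn; apply/LE'; rewrite g0 oppr0 mulr0.
by rewrite QE /= XY => /(pt_inj fr) [_]; lra.
Qed.

Section OppositeSides.
Context (I e f A B C D P : 'rV[R]_2) (x y : R).
Context (fr : rectangle_frame I e f A B C D).
Context (hP : P = pt I e f x y).
Context (ndg : nondegenerate_triangle P A B)
        (ndg' : nondegenerate_triangle P C D).
Context (neq : ~ equilateral P A B) (neq' : ~ equilateral P C D).
Let fr' := rectangle_frame_turn (rectangle_frame_turn fr).
Let p := dot e e.
Let q := dot f f.

Let hP' : P = pt I (- e) (- f) (- x) (- y).
Proof. by rewrite hP pt_half_turn. Qed.

Let dotNN U : dot (- U) (- U) = dot U U.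
Proof. by rewrite !dotE !mxE; ring. Qed.

(** The equation of the second axis is that of the first one with x, y, X and Y
    negated. Their sum therefore retains only the part of the first equation that
    is even in (x,y,X,Y), and this is 4 q (x Y + y X) = 0. *)
Lemma euler_opposite_sides L L' Q :
  is_euler_line L P A B -> is_euler_line L' P C D -> L `&` L' = [set Q] ->
  x != 0 /\ exists X Y, Q = pt I e f X Y /\ x * Y + y * X = 0.
Proof.
move=> EL EL' QE.
move: ndg neq EL; rewrite hP => nd ne EL.
move: ndg' neq' EL'; rewrite hP' => nd' ne' EL'.
have LE := euler_side fr nd ne EL; have LE' := euler_side fr' nd' ne' EL'.
have [x0 [X [Y [XY E E']]]] := opposite_axes_meet (frame_orthogonal fr) LE LE' QE.
split=> //; exists X, Y; split=> //.
rewrite /circle_power !dotNN in E E'.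
have [_ /dot_gt0 /lt0r_neq0 q0 _] := frame_orthogonal fr.
by apply: (mulfI q0); lra.
Qed.

(** Up to the factor x (and a common denominator) the first coordinate of M - P.
    Exchanging (p,x) with (q,y) gives the second one up to the factor - y; this
    antisymmetry is what makes M, N and P collinear. *)
Definition brocard_coef p q x y : R :=
  let n := p * x ^+ 2 + q * y ^+ 2 in
  4 * n * (p + q * y ^+ 2) - (n + p + q) ^+ 2.

(** The equation of the second axis is that of the first one with x, y, X and Y
    negated. The even part gives the slope of the line IM; with it, the odd part
    determines M. *)
Lemma brocard_opposite_sides L L' M :
  is_brocard_axis L P A B -> is_brocard_axis L' P C D -> L `&` L' = [set M] ->
  exists2 d, d != 0 & d *: (M - P) =
    (x * brocard_coef p q x y) *: e - (y * brocard_coef q p y x) *: f.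
Proof.
move=> BL BL' ME.
have y1 := nondegenerate_side fr; have y2 := nondegenerate_side fr'.
move: ndg neq BL; rewrite {1 2 3}hP => nd ne BL.
move: ndg' neq' BL'; rewrite {1 2 3}hP' => nd' ne' BL'.
have LE := brocard_side fr nd ne BL; have LE' := brocard_side fr' nd' ne' BL'.
rewrite (mulrN (4 * dot (- e) (- e)) x) !dotNN -/p -/q in LE LE'.
have [x0 [X [Y [XY E E']]]] := opposite_axes_meet (frame_orthogonal fr) LE LE' ME.
have {}y1 := y1 _ _ nd; have {}y2 := y2 _ _ nd'.
have [/dot_gt0 p0 /dot_gt0 q0 _] := frame_orthogonal fr.
rewrite -/p -/q in p0 q0.
set w := circle_power p q x y in E E'.
set n := p * x ^+ 2 + q * y ^+ 2.
set d := 4 * p * w - brocard_coef p q x y.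
have {}x0 : x != 0.
  by move: x0; rewrite mulf_eq0 negb_or => /andP[].
(* The sum of E and E', divided by 8 q. *)
have slope : X * y * (p - q - n) = 2 * p * x * Y.
  by apply: (mulfI (lt0r_neq0 q0)); move: E E'; rewrite /w /circle_power /n; lra.
have EX : X * d = 4 * p * w * x.
  (* The difference of E and E', with Y eliminated by the slope. *)
  have := congr1 ( *%R (8 * q * y)) slope; move: E E'.
  by rewrite /d /w /circle_power /brocard_coef /n; lra.
have EY : Y * d = 2 * w * y * (p - q - n).
  have c0 : 2 * p * x != 0 by rewrite !mulf_neq0 ?pnatr_eq0 ?(lt0r_neq0 p0).
  apply: (mulfI c0).
  by have := congr1 ( *%R d) slope;
     have := congr1 ( *%R (y * (p - q - n))) EX; rewrite /=; lra.
exists d.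
  apply/eqP => d0.
  have w0 : w = 0.
    have c0 : 4 * p * x != 0 by rewrite !mulf_neq0 ?pnatr_eq0 ?(lt0r_neq0 p0).
    by apply: (mulfI c0); move: EX; rewrite d0; lra.
  (* If d = w = 0, then n = p + q and d = 4 q (p + q) (1 - y^2), but y^2 <> 1. *)
  have : 4 * q * (p + q) * ((y + 1) * (- y + 1)) = 0.
    have nE : n = p + q by move: w0; rewrite /w /circle_power -/n; lra.
    by move: d0; rewrite /d w0 /brocard_coef -/n nE; lra.
  apply/eqP; rewrite !mulf_neq0 ?pnatr_eq0 ?(lt0r_neq0 q0) //.
  by rewrite lt0r_neq0 ?addr_gt0.
rewrite XY hP ptB scalerDr !scalerA -scaleNr.
congr (_ *: _ + _ *: _); first by move: EX; rewrite /d; lra.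
by move: EY; rewrite /d /w /circle_power /brocard_coef /n; lra.
Qed.

End OppositeSides.
End Frame.

Theorem theorem1 (F : realType) (A B C D I P : 'rV[F]_2)
    (hABCD : rectangle A B C D)
    (hIAC : I = midpoint A C) (hIBD : I = midpoint B D)
    (hPAB : nondegenerate_triangle P A B) (hPBC : nondegenerate_triangle P B C)
    (hPCD : nondegenerate_triangle P C D) (hPDA : nondegenerate_triangle P D A) :
  (forall (ePAB ePBC ePCD ePDA : set 'rV[F]_2) (Q R : 'rV[F]_2),
      ~ equilateral P A B -> ~ equilateral P B C ->
      ~ equilateral P C D -> ~ equilateral P D A ->
      is_euler_line ePAB P A B -> is_euler_line ePBC P B C ->
      is_euler_line ePCD P C D -> is_euler_line ePDA P D A ->
      ePAB `&` ePCD = [set Q] -> ePBC `&` ePDA = [set R] -> Q != R ->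
      line Q R I) /\
  (forall (bPAB bPBC bPCD bPDA : set 'rV[F]_2) (M N : 'rV[F]_2),
      ~ equilateral P A B -> ~ equilateral P B C ->
      ~ equilateral P C D -> ~ equilateral P D A ->
      is_brocard_axis bPAB P A B -> is_brocard_axis bPBC P B C ->
      is_brocard_axis bPCD P C D -> is_brocard_axis bPDA P D A ->
      bPAB `&` bPCD = [set M] -> bPBC `&` bPDA = [set N] -> M != N ->
      line M N P).
Proof.
have fr := rectangle_has_frame hABCD hIAC hIBD.
set e := 2^-1 *: (B - A) in fr; set f := 2^-1 *: (D - A) in fr.
have fr1 := rectangle_frame_turn fr.
have [x [y hP]] := pt_surj I P (frame_orthogonal fr).
have hP1 : P = pt I f (- e) y (- x) by rewrite hP pt_turn.
split.
  move=> eAB eBC eCD eDA Q R nAB nBC nCD nDA EAB EBC ECD EDA HQ HR QR.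
  have [x0 [X [Y [QE E]]]] := euler_opposite_sides fr hP hPAB hPCD nAB nCD EAB ECD HQ.
  have [_ [X' [Y' [RE E']]]] := euler_opposite_sides fr1 hP1 hPBC hPDA nBC nDA EBC EDA HR.
  have {}RE : R = pt I e f (- Y') X' by rewrite RE [RHS]pt_turn opprK.
  have -> : I = pt I e f 0 0 by rewrite /pt !scale0r !addr0.
  rewrite QE RE in QR *; apply/(line_ptE _ _ (frame_orthogonal fr) QR).
  apply: (mulfI x0).
  have := congr1 ( *%R X) E'; have := congr1 ( *%R Y') E; rewrite /=; lra.
move=> bAB bBC bCD bDA M N nAB nBC nCD nDA EAB EBC ECD EDA HM HN MN.
have [d d0 ME] := brocard_opposite_sides fr hP hPAB hPCD nAB nCD EAB ECD HM.
have [d' _ NE] := brocard_opposite_sides fr1 hP1 hPBC hPDA nBC nDA EBC EDA HN.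
apply: (line_barycenter MN _ d0 (b := d')); rewrite ME NE.
have -> : dot (- e) (- e) = dot e e by rewrite !dotE !mxE; ring.
by rewrite /brocard_coef; apply/plane_eqP; rewrite !mxE; split; ring.
Qed.
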